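(* Let $M$ be an intra-regular $po$-$\Gamma$-semigroup. Then the set $(x)_{\mathcal{N}}$ is a maximal simple subsemigroup of $M$ for every $x\in M$. Conversely, if $T$ is a maximal simple subsemigroup of $M$, then there exists $x\in M$ such that $T=(x)_{\mathcal{N}}$.
   Context: A $po$-$\Gamma$-semigroup is a nonempty set $M$ with a nonempty set $\Gamma$ of binary operations on $M$, satisfying $(a\gamma b)\mu c=a\gamma(b\mu c)$ for all $a,b,c\in M$ and $\gamma,\mu\in\Gamma$, and a partial order $\le$ on $M$ such that $a\le b$ implies $a\gamma c\le b\gamma c$ and $c\gamma a\le c\gamma b$ for all $c\in M$, $\gamma\in\Gamma$. For $A,B\subseteq M$, $A\Gamma B=\{a\gamma b\mid a\in A,\ b\in B,\ \gamma\in\Gamma\}$ (and similarly for longer products, with singletons written as elements; e.g. $M\Gamma x\gamma x\Gamma M=\{a\delta x\gamma x\xi b\mid a,b\in M,\ \delta,\xi\in\Gamma\}$ for fixed $\gamma$). For $H\subseteq M$, $(H]=\{t\in M\mid t\le a \text{ for some } a\in H\}$. $M$ is intra-regular if $x\in(M\Gamma x\gamma x\Gamma M]$ for every $x\in M$ and every $\gamma\in\Gamma$. An ideal of $M$ is a nonempty subset $A$ with $M\Gamma A\subseteq A$, $A\Gamma M\subseteq A$, and such that $a\in A$, $b\in M$, $b\le a$ imply $b\in A$. A subsemigroup of $M$ is a nonempty subset $A$ with $A\Gamma A\subseteq A$; it is itself a $po$-$\Gamma$-semigroup with the restricted operations and order. A $po$-$\Gamma$-semigroup is simple if it is the only ideal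 of itself; a subsemigroup is simple if it is simple as a $po$-$\Gamma$-semigroup in its own right. A maximal simple subsemigroup of $M$ is a simple subsemigroup not properly contained in any other simple subsemigroup of $M$. A filter of $M$ is a subsemigroup $F$ such that (i) $a,b\in M$, $\gamma\in\Gamma$, $a\gamma b\in F$ imply $a\in F$ and $b\in F$; (ii) $a\in F$, $c\in M$, $c\ge a$ imply $c\in F$. $N(x)$ denotes the filter of $M$ generated by $x$ (the smallest filter containing $x$), $\mathcal{N}$ is the equivalence relation $a\,\mathcal{N}\,b\Leftrightarrow N(a)=N(b)$, and $(x)_{\mathcal{N}}$ is the $\mathcal{N}$-class of $x$. *)

(* Defs.v *)
From HB Require Import structures.
From mathcomp Require Import all_boot all_order.
From mathcomp Require Import boolp classical_sets.

Set Implicit Arguments.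
Unset Strict Implicit.
Unset Printing Implicit Defensive.

Import Order.TTheory.

Local Open Scope order_scope.
Local Open Scope classical_set_scope.

Record poGammaSemigroup (d : Order.disp_t) := PoGammaSemigroup {
  poG_sort :> porderType d;
  Gamma : set (poG_sort -> poG_sort -> poG_sort);
  poG_nonempty : [set: poG_sort] !=set0;
  Gamma_nonempty : Gamma !=set0;
  poG_assoc : forall g m, Gamma g -> Gamma m ->
    forall a b c, m (g a b) c = g a (m b c);
  poG_monol : forall g, Gamma g -> forall a b c, a <= b -> g a c <= g b c;
  poG_monor : forall g, Gamma g -> forall a b c, a <= b -> g c a <= g c b
}.
Arguments Gamma {d} M : rename.

Section Notions.
Variables (d : Order.disp_t) (M : poGammaSemigroup d).
Implicit Types (A F H T : set M) (x : M).

Definition Gprod A B : set M :=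
  [set t | exists g a b, [/\ Gamma M g, A a, B b & t = g a b]].

Definition downset H : set M := [set t | exists2 a, H a & t <= a].

(* By associativity M Gamma x g x Gamma M is bracketed as
   (M Gamma (x g x)) Gamma M. *)
Definition intra_regular : Prop :=
  forall x g, Gamma M g ->
    downset (Gprod (Gprod [set: M] [set g x x]) [set: M]) x.

Definition ideal A : Prop :=
  [/\ A !=set0, Gprod [set: M] A `<=` A, Gprod A [set: M] `<=` A
    & forall a b, A a -> b <= a -> A b].

Definition simple : Prop := forall A, ideal A <-> A = [set: M].

Definition subsemigroup A : Prop := A !=set0 /\ Gprod A A `<=` A.

Definition Gfilter F : Prop :=
  [/\ subsemigroup F,
      forall g a b, Gamma M g -> F (g a b) -> F a /\ F b
    & forall a c, F a -> a <= c -> F c].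

(* The intersection of all filters containing x, which is itself a filter
   (genfilter_filter). *)
Definition genfilter x : set M := smallest Gfilter [set x].

Lemma genfilter_filter x : Gfilter (genfilter x).
Proof.
split.
- split; first by exists x => F [_]; apply.
  move=> _ [g [a [b [Gg Na Nb ->]]]] F FF.
  have [[_ FG] _ _] := FF.1.
  by apply: FG; exists g, a, b; split=> //; [apply: Na | apply: Nb].
- by move=> g a b Gg Nab; split=> F FF; have [_ Fdiv _] := FF.1;
    have [] := Fdiv g a b Gg (Nab F FF).
- by move=> a c Na ac F FF; have [_ _ Fup] := FF.1; apply: Fup ac; apply: Na.
Qed.

Definition Nrel (a b : M) : Prop := genfilter a = genfilter b.

Definition Nclass x : set M := [set y | Nrel x y].

End Notions.

Section Subsemigroup.
Variables (d : Order.disp_t) (M : poGammaSemigroup d) (A : set M).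

HB.instance Definition _ := [SubChoice_isSubPOrder of {x : M | x \in A} by <: with d].

(* The restrictions to A of the operations in Gamma. *)
Definition subGamma : set (A -> A -> A) :=
  [set h | exists2 g, Gamma M g & forall a b : A, val (h a b) = g (val a) (val b)].

Hypothesis hA : subsemigroup A.

Fact sub_nonempty : [set: A] !=set0.
Proof. by have [[a Aa] _] := hA; exists (SigSub (mem_set Aa)). Qed.

Fact subGamma_nonempty : subGamma !=set0.
Proof.
have [g Gg] := Gamma_nonempty M.
have Ag (a b : A) : g (val a) (val b) \in A.
  apply/mem_set/hA.2; exists g, (val a), (val b).
  by split=> //; apply: set_mem (valP _).
by exists (fun a b => SigSub (Ag a b)); exists g.
Qed.

Fact sub_assoc g m : subGamma g -> subGamma m ->
  forall a b c, m (g a b) c = g a (m b c).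
Proof.
move=> [g' Gg gE] [m' Gm mE] a b c; apply: val_inj.
by rewrite mE !gE mE (poG_assoc Gg Gm).
Qed.

Fact sub_monol g : subGamma g -> forall a b c : A, a <= b -> g a c <= g b c.
Proof. by move=> [g' Gg gE] a b c; rewrite !leEsub !gE; apply: poG_monol. Qed.

Fact sub_monor g : subGamma g -> forall a b c : A, a <= b -> g c a <= g c b.
Proof. by move=> [g' Gg gE] a b c; rewrite !leEsub !gE; apply: poG_monor. Qed.

Definition subPoG : poGammaSemigroup d :=
  PoGammaSemigroup sub_nonempty subGamma_nonempty sub_assoc sub_monol sub_monor.

End Subsemigroup.

Section Maximal.
Variables (d : Order.disp_t) (M : poGammaSemigroup d).

Definition simple_subsemigroup (T : set M) : Prop :=
  exists hT : subsemigroup T, simple (subPoG hT).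

Definition maximal_simple_subsemigroup (T : set M) : Prop :=
  simple_subsemigroup T /\
  forall S : set M, simple_subsemigroup S -> ~ T `<` S.

End Maximal.
Arguments intra_regular {d} M.
Arguments simple {d} M.

(* Main.v *)
Require Import Defs.
From mathcomp Require Import all_boot all_order.
From mathcomp Require Import boolp classical_sets.

(** Say that [x] lies under [y] when [x] belongs to (M Gamma y Gamma M], i.e.
    when [x <= a g y h b] for some [a], [b] in M and [g], [h] in Gamma.

    In an intra-regular M this relation is a preorder, and multiplication
    behaves in it like a meet: a product lies under both factors, and every
    common lower bound of two elements lies under all their products
    ([under_meet]).  The key point is that products commute up to it
    ([under_comm]): [a g b] lies under its square [(a g b) h (a g b)], whose middle
    factor is [b h a].  Hence the elements above [x] form a filter, clearly the least one
    containing [x] ([genfilterE]), and the N-classes are exactly the classes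
    of mutual [under].

    Every class is simple: if [y] and [a] are in the same class then [y] lies
    under [a g a g a], and the two outer copies of [a] pull the unknown factors
    of M back into the class, so [y <= p g a g q] with [p], [q] in the class
    ([simple_Nclass]).  Conversely a simple subsemigroup T lies in one class,
    because for [y] in T the elements of T lying under [y] form an ideal of T
    ([simple_sub_Nclass]).  So every simple subsemigroup lies in a
    class, which is itself simple, and distinct classes are disjoint; hence the
    maximal ones are the classes. *)

Set Implicit Arguments.
Unset Strict Implicit.
Unset Printing Implicit Defensive.

Import Order.TTheory.

Local Open Scope order_scope.
Local Open Scope classical_set_scope.

Section Under.
Variables (d : Order.disp_t) (M : poGammaSemigroup d).
Implicit Types (a b p u x y z w : M).

Definition under x y : Prop :=
  exists g h a b, [/\ Gamma M g, Gamma M h & x <= h (g a y) b].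

Lemma le_under_trans x y z : x <= y -> under y z -> under x z.
Proof.
move=> xy [g [h [a [b [Gg Gh yz]]]]]; exists g, h, a, b.
by split=> //; apply: le_trans yz.
Qed.

Lemma under_trans x y z : under x y -> under y z -> under x z.
Proof.
move=> [g [h [a [b [Gg Gh xy]]]]] [k [l [a' [b' [Gk Gl yz]]]]].
exists k, l, (g a a'), (h b' b); split=> //; apply: le_trans xy _.
have -> : l (k (g a a') z) (h b' b) = h (g a (l (k a' z) b')) b.
  by rewrite (poG_assoc Gg Gk) -(poG_assoc Gl Gh) -(poG_assoc Gg Gl).
by apply: (poG_monol Gh); apply: (poG_monor Gg).
Qed.

Lemma under_mid g h a b y :
  Gamma M g -> Gamma M h -> under (h (g a y) b) y.
Proof. by exists g, h, a, b. Qed.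

Hypothesis hM : intra_regular M.

Lemma under_square g x : Gamma M g -> under x (g x x).
Proof.
move=> Gg; have [_ [h [_ [b [Gh [k [a [_ [Gk _ -> ->]]]] _ ->]]]] xle] := hM x Gg.
by exists k, h, a, b.
Qed.

Lemma under_mull g p u : Gamma M g -> under (g p u) p.
Proof.
move=> Gg; apply: under_trans (under_square (g p u) Gg) _.
rewrite -(poG_assoc Gg Gg); exact: (under_mid _ _ _ Gg Gg).
Qed.

Lemma under_mulr g p u : Gamma M g -> under (g u p) p.
Proof.
move=> Gg; apply: under_trans (under_square (g u p) Gg) _.
exact: (under_mid _ _ _ Gg Gg).
Qed.

Lemma under_refl x : under x x.
Proof.
have [g Gg] := Gamma_nonempty M.
exact: under_trans (under_square x Gg) (under_mull x x Gg).
Qed.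

Lemma le_under x y : x <= y -> under x y.
Proof. by move=> xy; apply: le_under_trans xy (under_refl y). Qed.

(** Since [(a g b) h (a g b) = a g (b h a) g b], the square of a product has
    the reversed product in its middle. *)
Lemma under_comm g h a b : Gamma M g -> Gamma M h -> under (g a b) (h b a).
Proof.
move=> Gg Gh; apply: under_trans (under_square (g a b) Gh) _.
rewrite -(poG_assoc Gh Gg) (poG_assoc Gg Gh).
exact: (under_mid _ _ _ Gg Gg).
Qed.

(** Bounding the two factors of [x g x] separately shows that [x] lies under
    some [z h u k w] with [h], [k] in Gamma; commuting [z h u] past [w] puts the
    spurious factor [u] at the end, where it is absorbed. *)
Lemma under_meet g x z w :
  Gamma M g -> under x z -> under x w -> under x (g z w).
Proof.
move=> Gg [k [h [a [b [Gk Gh xz]]]]] [k' [h' [c [e [Gk' Gh' xw]]]]].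
apply: under_trans (under_square x Gg) _.
have xx : g x x <= g (h (k a z) b) (h' (k' c w) e).
  exact: le_trans (poG_monol Gg _ xz) (poG_monor Gg _ xw).
apply: le_under_trans xx _.
have -> : g (h (k a z) b) (h' (k' c w) e)
        = h' (k a (k' (h z (g b c)) w)) e.
  rewrite -(poG_assoc Gg Gh') -(poG_assoc Gg Gk') -(poG_assoc Gk Gk').
  by rewrite -(poG_assoc Gk Gh) -(poG_assoc Gh Gg).
apply: under_trans (under_mid _ _ _ Gk Gh') _.
apply: under_trans (under_comm _ _ Gk' Gg) _.
rewrite -(poG_assoc Gg Gh).
apply: under_trans (under_mull _ _ Gh) _.
exact: under_comm.
Qed.

(** Any filter containing [x] contains every [y] above [x], because it splits
    [a g y h b] into its factors; [under_meet] gives the only filter axiom of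
    the set of these [y] that is not immediate. *)
Lemma genfilterE x : genfilter x = under x.
Proof.
apply/seteqP; split=> y.
  apply; split; last by move=> _ ->; apply: under_refl.
  split.
  - split; first by exists x; apply: under_refl.
    by move=> _ [g [a [b [Gg xa xb ->]]]]; apply: under_meet.
  - move=> g a b Gg xab; split; apply: under_trans xab _.
      exact: under_mull.
    exact: under_mulr.
  - by move=> a c xa ac; apply: under_trans xa (le_under ac).
move=> [g [h [a [b [Gg Gh xy]]]]] F [[_ Fdiv Fup] Fx].
have [Fay _] := Fdiv _ _ _ Gh (Fup _ _ (Fx x erefl) xy).
by have [] := Fdiv _ _ _ Gg Fay.
Qed.

Lemma NclassP x y : Nclass x y <-> under x y /\ under y x.
Proof.
rewrite /Nclass /= /Nrel !genfilterE; split=> [xy|[xy yx]].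
  by split; [rewrite xy | rewrite -xy]; apply: under_refl.
apply/seteqP; split=> z; exact: under_trans.
Qed.

End Under.

(** Ideals of [subPoG hT] are sets of elements of a subtype; this lemma
    expresses simplicity of T through subsets of M, which are only constrained
    on their trace on T. *)
Lemma simple_subPoGP (d : Order.disp_t) (M : poGammaSemigroup d) (T : set M)
    (hT : subsemigroup T) :
  simple (subPoG hT) <->
  forall B : set M, T `&` B !=set0 ->
    (forall g a b, Gamma M g -> T a -> T b -> B b -> B (g a b) /\ B (g b a)) ->
    (forall a b, T a -> T b -> B a -> b <= a -> B b) ->
    T `<=` B.
Proof.
split=> [sT B [b [Tb Bb]] Bmul Bdown|sT A].
  have idB : ideal (M := subPoG hT) [set t | B (val t)].
    split.
    - by exists (SigSub (mem_set Tb)).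
    - move=> _ [g [a [c [[g' Gg' gE] _ Bc ->]]]] /=; rewrite gE.
      by have [] := Bmul _ _ _ Gg' (set_mem (valP a)) (set_mem (valP c)) Bc.
    - move=> _ [g [c [a [[g' Gg' gE] Bc _ ->]]]] /=; rewrite gE.
      by have [] := Bmul _ _ _ Gg' (set_mem (valP a)) (set_mem (valP c)) Bc.
    - move=> a c Ba ca; apply: (Bdown (val a)) => //; exact: set_mem (valP _).
  move=> t Tt; have /seteqP[_ /(_ (SigSub (mem_set Tt)) I)] := (sT _).1 idB.
  by [].
split=> [[[a Aa] Al Ar Ad]|->]; last first.
  by split=> //; apply: sub_nonempty.
apply/seteqP; split=> // t _.
pose B : set M := [set y | exists2 s : subPoG hT, A s & val s = y].
have BA s : B (val s) -> A s by move=> [s' As' /val_inj <-].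
apply: BA; apply: sT (set_mem (valP t)).
- by exists (val a); split; [exact: set_mem (valP a) | exists a].
- move=> g p _ Gg Tp _ [q Aq <-].
  have Tg (r s : T) : g (val r) (val s) \in T.
    apply/mem_set/hT.2; exists g, (val r), (val s).
    by split=> //; apply: set_mem (valP _).
  pose gT (r s : T) : T := SigSub (Tg r s).
  have GgT : Gamma (subPoG hT) gT by exists g.
  pose p' : T := SigSub (mem_set Tp).
  split.
    by exists (gT p' q) => //; apply: Al; exists gT, p', q.
  by exists (gT q p') => //; apply: Ar; exists gT, q, p'.
- move=> _ b _ Tb [q Aq <-] bq.
  by exists (SigSub (mem_set Tb)) => //; apply: Ad Aq _.
Qed.

Section Classes.
Variables (d : Order.disp_t) (M : poGammaSemigroup d) (hM : intra_regular M).

Lemma subsemigroup_Nclass (x : M) : subsemigroup (Nclass x).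
Proof.
split; first by exists x; rewrite /Nclass /= /Nrel.
move=> _ [g [a [b [Gg /(NclassP hM)[xa ax] /(NclassP hM)[xb _] ->]]]].
apply/(NclassP hM); split; first exact: under_meet.
by apply: under_trans ax; apply: under_mull.
Qed.

(** The exponent three leaves one copy of [a] in the middle, to be multiplied
    within the ideal, and one on each side to bring the unknown factors [b] and
    [c] of M into the class. *)
Lemma simple_Nclass (x : M) : simple_subsemigroup (Nclass x).
Proof.
exists (subsemigroup_Nclass x); apply/simple_subPoGP.
move=> B [a [Ca Ba]] Bmul Bdown y Cy.
have [xa ax] := (NclassP hM x a).1 Ca.
have [xy yx] := (NclassP hM x y).1 Cy.
have [g Gg] := Gamma_nonempty M.
have ya : under y a by apply: under_trans yx xa.
have [k [h [b [c [Gk Gh]]]]] : under y (g (g a a) a).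
  by do 2![apply: under_meet => //].
have -> : h (k b (g (g a a) a)) c = g (g (k b a) a) (h a c).
  by rewrite -(poG_assoc Gk Gg) -(poG_assoc Gk Gg) (poG_assoc Gg Gh).
move=> yle; have yprod := le_under hM yle.
(* Both [k b a] and [h a c] lie under [a] and above [y]. *)
have Cp : Nclass x (k b a).
  apply/(NclassP hM); split; last exact: under_trans (under_mulr hM _ _ Gk) ax.
  apply: under_trans xy _; apply: under_trans yprod _.
  apply: under_trans (under_mull hM _ _ Gg) _; exact: under_mull.
have Cq : Nclass x (h a c).
  apply/(NclassP hM); split; last exact: under_trans (under_mull hM _ _ Gh) ax.
  apply: under_trans xy _; apply: under_trans yprod _; exact: under_mulr.
have Cmul p q : Nclass x p -> Nclass x q -> Nclass x (g p q).
  by move=> Hp Hq; apply: (subsemigroup_Nclass x).2; exists g, p, q.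
have Cpa := Cmul _ _ Cp Ca.
have [Bpa _] := Bmul g _ _ Gg Cp Ca Ba.
have [_ Bpaq] := Bmul g _ _ Gg Cq Cpa Bpa.
exact: Bdown (Cmul _ _ Cpa Cq) Cy Bpaq yle.
Qed.

(** A product lies under each of its factors, so the elements of T lying under
    a given [y] in T form an ideal of T, hence all of T. *)
Lemma simple_sub_Nclass (T : set M) (x : M) :
  simple_subsemigroup T -> T x -> T `<=` Nclass x.
Proof.
move=> [hT /simple_subPoGP sT] Tx.
have Tunder y : T y -> T `<=` [set t | under t y].
  move=> Ty; apply: sT.
  - by exists y; split=> //; apply: under_refl.
  - move=> g a b Gg _ _ /= by_; split; apply: under_trans by_.
      exact: under_mulr.
    exact: under_mull.
  - by move=> a b _ _ /= ay ba; apply: le_under_trans ba ay.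
by move=> y Ty; apply/(NclassP hM); split; apply: Tunder.
Qed.

End Classes.

Theorem theorem18 (d : Order.disp_t) (M : poGammaSemigroup d)
    (hM : intra_regular M) :
  (forall x : M, maximal_simple_subsemigroup (Nclass x)) /\
  (forall T : set M, maximal_simple_subsemigroup T ->
     exists x : M, T = Nclass x).
Proof.
split=> [x|T [sT maxT]].
  split=> [|S sS [xS]]; first exact: simple_Nclass.
  by apply; apply: simple_sub_Nclass => //; apply: xS.
have [[[x Tx] _] _] := sT; exists x.
have Tsub := simple_sub_Nclass hM sT Tx.
apply: contrapT => TneC; apply: (maxT _ (simple_Nclass hM x)).
by split=> // Csub; apply: TneC; apply/seteqP.
Qed.
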